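(* Let $k\in\{1,2,3,4,5\}$ and let $\delta t>0$ be arbitrary. Consider the $k$th-order implicit-explicit BDF$k$ SAV scheme (defined in the context) for the dissipative system $\frac{\partial u}{\partial t}+\mathcal{A}u+g(u)=0$ with energy law $\frac{d\tilde E(u)}{dt}=-\mathcal{K}(u)$ and shifted energy $E=\tilde E+C_0>0$. Given $r^n\ge 0$, we have $r^{n+1}\ge 0$, $\xi^{n+1}\ge 0$, and the scheme is unconditionally energy stable (i.e. for every $\delta t>0$) in the sense that $$r^{n+1}-r^{n}=-\delta t\,\xi^{n+1}\mathcal{K}(\bar u^{n+1})\le 0.$$ Furthermore, if $E(u)=\frac12(\mathcal{L}u,u)+E_1(u)$ with $\mathcal{L}$ a positive linear operator and $E_1(u)$ bounded from below, then there exists a constant $M_k>0$ such that $$(\mathcal{L}u^n,u^n)\le M_k^2\qquad\text{for all } n.$$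
   Context: $\Omega\subset\mathbb{R}^d$ ($d=1,2,3$) is a bounded domain with sufficiently smooth boundary; $(\cdot,\cdot)$ and $\|\cdot\|$ are the inner product and norm of $L^2(\Omega)$. Dissipative system: $\frac{\partial u}{\partial t}+\mathcal{A}u+g(u)=0$, where $u$ is a scalar or vector function, $\mathcal{A}$ is a positive differential operator and $g(u)$ is a nonlinear operator possibly with lower-order derivatives. It is assumed to satisfy the dissipative energy law $\frac{d\tilde E(u)}{dt}=-\mathcal{K}(u)$, where $\tilde E$ is an energy functional with $\tilde E(u)>-C_0$ for all $u$ ($C_0$ a constant), and $\mathcal{K}(u)>0$ for all $u\ne 0$ (and $\mathcal{K}(0)\ge 0$). Set $E(u):=\tilde E(u)+C_0>0$. Scheme of order $k$ with time step $\delta t$: start from $u^0=\bar u^0=u(\cdot,0)$, $r^0=E(u^0)$ (for $k\ge2$ the first $k-1$ steps are obtained by an initialization procedure). Given the previous values, compute $\bar u^{n+1}, r^{n+1},\xi^{n+1},u^{n+1}$ consecutively by $$\frac{\alpha_k\bar u^{n+1}-A_k(u^n)}{\delta t}+\mathcal{A}\bar u^{n+1}+g[B_k(\bar u^n)]=0,$$ $$\frac{1}{\delta t}\big(r^{n+1}-r^n\big)=-\frac{r^{n+1}}{E(\bar u^{n+1})}\mathcal{K}(\bar u^{n+1}),$$ $$\xi^{n+1}=\frac{r^{n+1}}{E(\bar u^{n+1})},\qquad u^{n+1}=\eta_k^{n+1}\bar u^{n+1},\qquad \eta_k^{n+1}=1-(1-\xi^{n+1})^{k+1}.$$ Coefficients: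 $k=1$: $\alpha_1=1$, $A_1(u^n)=u^n$, $B_1(\bar u^n)=\bar u^n$. $k=2$: $\alpha_2=\frac32$, $A_2(u^n)=2u^n-\frac12u^{n-1}$, $B_2(\bar u^n)=2\bar u^n-\bar u^{n-1}$. $k=3$: $\alpha_3=\frac{11}{6}$, $A_3(u^n)=3u^n-\frac32u^{n-1}+\frac13u^{n-2}$, $B_3(\bar u^n)=3\bar u^n-3\bar u^{n-1}+\bar u^{n-2}$. $k=4$: $\alpha_4=\frac{25}{12}$, $A_4(u^n)=4u^n-3u^{n-1}+\frac43u^{n-2}-\frac14u^{n-3}$, $B_4(\bar u^n)=4\bar u^n-6\bar u^{n-1}+4\bar u^{n-2}-\bar u^{n-3}$. $k=5$: $\alpha_5=\frac{137}{60}$, $A_5(u^n)=5u^n-5u^{n-1}+\frac{10}{3}u^{n-2}-\frac54u^{n-3}+\frac15u^{n-4}$, $B_5(\bar u^n)=5\bar u^n-10\bar u^{n-1}+10\bar u^{n-2}-5\bar u^{n-3}+\bar u^{n-4}$.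
   Formalization: In the ''Furthermore'' part, the shifted energy E is additionally assumed bounded below by a positive constant (C_0 chosen large enough), since with only E > 0 the bound on (L u^n, u^n) can fail. *)

(* Defs.v *)
From HB Require Import structures.
From mathcomp Require Import all_boot all_order all_algebra.
From mathcomp Require Import all_classical all_reals all_analysis.

Set Implicit Arguments.
Unset Strict Implicit.
Unset Printing Implicit Defensive.
Import Order.TTheory GRing.Theory Num.Theory.
Import numFieldNormedType.Exports.

Local Open Scope classical_set_scope.
Local Open Scope ring_scope.

Section LebesgueMeasure.
Context {R : realType}.

Definition tcons (d : nat) (p : d.-tuple (measurableTypeR R) * measurableTypeR R) :
    d.+1.-tuple (measurableTypeR R) :=
  [tuple of p.2 :: p.1].

Lemma measurable_tcons (d : nat) : measurable_fun setT (@tcons d).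
Proof. by apply: measurable_cons; [exact: measurable_snd|exact: measurable_fst]. Qed.

Definition lebesgue_step (d : nat)
    (mu : {measure set (d.-tuple (measurableTypeR R)) -> \bar R}) :=
  pushforward (mu \x lebesgue_measure)%E (@tcons d).

HB.instance Definition _ (d : nat)
    (mu : {measure set (d.-tuple (measurableTypeR R)) -> \bar R}) :=
  Measure.copy (lebesgue_step mu)
    (measure_function_pushforward__canonical__measure_function_Measure
       (mu \x lebesgue_measure)%E (@measurable_tcons d)).

(* Lebesgue measure on R^d, as the image in d.-tuple R of the d-fold product of
   the Lebesgue measure on R. *)
Fixpoint lebesgue_tuple (d : nat) :
    {measure set (d.-tuple (measurableTypeR R)) -> \bar R} :=
  match d with
  | 0 => dirac ([tuple] : 0.-tuple (measurableTypeR R))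
  | d'.+1 => lebesgue_step (lebesgue_tuple d')
  end.

(* The topology and the derivatives live on 'rV[R]_d, the sigma-algebra and the
   measure on d.-tuple R; [row_of] is the identification of the two. *)
Definition row_of (d : nat) (t : d.-tuple (measurableTypeR R)) : 'rV[R]_d := \row_i tnth t i.

End LebesgueMeasure.

Section Differentiability.
Context {R : realType} {d : nat}.

Definition partial (i : 'I_d) (f : 'rV[R]_d -> R) : 'rV[R]_d -> R :=
  fun x => 'D_(delta_mx 0 i) f x.

Definition partials (s : seq 'I_d) (f : 'rV[R]_d -> R) : 'rV[R]_d -> R :=
  foldr partial f s.

Definition Ck (p : nat) (f : 'rV[R]_d -> R) : Prop :=
  forall s : seq 'I_d, (size s <= p)%N ->
    continuous (partials s f) /\
    ((size s < p)%N -> forall (i : 'I_d) (x : 'rV[R]_d),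
       derivable (partials s f) x (delta_mx 0 i)).

Definition frontier (Omega : set 'rV[R]_d) : set 'rV[R]_d :=
  closure Omega `\` interior Omega.

Definition Ck_boundary (p : nat) (Omega : set 'rV[R]_d) : Prop :=
  forall x, frontier Omega x ->
    exists (U : set 'rV[R]_d) (rho : 'rV[R]_d -> R),
      [/\ nbhs x U, Ck p rho, exists i, partial i rho x != 0 &
          Omega `&` U = [set y | rho y < 0] `&` U].

Definition bounded_domain (Omega : set 'rV[R]_d) : Prop :=
  [/\ Omega !=set0, open Omega, connected Omega & bounded_set Omega].

Definition test_function (Omega : set 'rV[R]_d) (phi : 'rV[R]_d -> R) : Prop :=
  (forall p, Ck p phi) /\
  exists C : set 'rV[R]_d,
    [/\ compact C, C `<=` Omega & forall x, ~ C x -> phi x = 0].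

Definition integral_on (Omega : set 'rV[R]_d) (f : 'rV[R]_d -> R) : R :=
  \int[lebesgue_tuple d]_(t in @row_of R d @^-1` Omega) f (row_of t).

Definition integrable_on (Omega : set 'rV[R]_d) (f : 'rV[R]_d -> R) : Prop :=
  (lebesgue_tuple d).-integrable (@row_of R d @^-1` Omega)
    (fun t => (f (row_of t))%:E).

(* [h] is the weak derivative of [f] in [Omega] along the word [s]. *)
Definition weak_partials (Omega : set 'rV[R]_d) (s : seq 'I_d)
    (f h : 'rV[R]_d -> R) : Prop :=
  (forall C, compact C -> C `<=` Omega -> integrable_on C h) /\
  forall phi, test_function Omega phi ->
    integral_on Omega (fun x => h x * phi x) =
    (-1) ^+ size s * integral_on Omega (fun x => f x * partials s phi x).

End Differentiability.

(* Elements of L^2(Omega)^m are represented by functions on all of R^d, of which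
   only the values on Omega matter, compared by equality a.e. in Omega. *)
Section L2.
Context {R : realType} {d m : nat} (Omega : set 'rV[R]_d).
Local Notation V := ('rV[R]_d -> 'rV[R]_m).

Definition aeq (u v : V) : Prop :=
  {ae lebesgue_tuple d, forall t, Omega (row_of t) ->
                                  u (row_of t) = v (row_of t)}.

Definition L2 (u : V) : Prop := forall i : 'I_m,
  measurable_fun (@row_of R d @^-1` Omega) (fun t => u (row_of t) 0 i) /\
  integrable_on Omega (fun x => u x 0 i ^+ 2).

Definition inner (u v : V) : R :=
  integral_on Omega (fun x => \sum_(i < m) u x 0 i * v x 0 i).

Definition L2norm (u : V) : R := Num.sqrt (inner u u).

(* [X] is a space of functions (encoding regularity and boundary conditions), a
   linear subspace of L^2 that is a union of a.e.-classes. *)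
Definition function_space (X : set V) : Prop :=
  [/\ X `<=` L2, X 0,
      forall (a : R) u v, X u -> X v -> X (a *: u + v) &
      forall u v, aeq u v -> X u -> X v].

(* An operator in L^2 with domain [X], well defined on a.e.-classes. *)
Definition operator_on (X : set V) (T : V -> V) : Prop :=
  (forall u, X u -> L2 (T u)) /\
  (forall u v, X u -> X v -> aeq u v -> aeq (T u) (T v)).

Definition functional_on (X : set V) (F : V -> R) : Prop :=
  forall u v, X u -> X v -> aeq u v -> F u = F v.

Definition linear_on (X : set V) (T : V -> V) : Prop :=
  forall (a : R) u v, X u -> X v -> aeq (T (a *: u + v)) (a *: T u + T v).

Definition positive_on (X : set V) (T : V -> V) : Prop :=
  forall u, X u -> 0 <= inner (T u) u.

(* T u = sum over the words s of length <= N of a_s . (d^s u), with matrix-valued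
   coefficients a_s and weak derivatives; every u in [X] has these derivatives. *)
Definition differential_operator (X : set V) (T : V -> V) : Prop :=
  exists (N : nat) (a : seq 'I_d -> 'rV[R]_d -> 'M[R]_m), forall u, X u ->
    exists D : seq 'I_d -> V,
      (forall s (i : 'I_m), (size s <= N)%N ->
         weak_partials Omega s (fun x => u x 0 i) (fun x => D s x 0 i)) /\
      aeq (T u) (fun x =>
        \sum_(l < N.+1) \sum_(s : l.-tuple 'I_d) D s x *m (a s x)^T).

Definition positive_differential_operator (X : set V) (A : V -> V) : Prop :=
  [/\ operator_on X A, linear_on X A, positive_on X A &
      differential_operator X A].

Definition positive_linear_operator (X : set V) (L : V -> V) : Prop :=
  [/\ operator_on X L, linear_on X L & positive_on X L].

Definition time_derivative (u : R -> V) (t : R) (w : V) : Prop :=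
  L2norm (h^-1 *: (u (t + h) - u t) - w) @[h --> 0^'] --> (0 : R).

Definition L2_continuous_at (w : R -> V) (t : R) : Prop :=
  L2norm (w s - w t) @[s --> t] --> (0 : R).

(* Strict solutions on ]0, T[ of u_t + A u + g(u) = 0. *)
Definition solution (X : set V) (A g : V -> V) (T : R) (u : R -> V) : Prop :=
  forall t, 0 < t < T ->
    [/\ X (u t), time_derivative u t (- (A (u t) + g (u t))),
        L2_continuous_at (A \o u) t & L2_continuous_at (g \o u) t].

Definition energy_law (X : set V) (A g : V -> V) (Et K : V -> R) : Prop :=
  forall T u, solution X A g T u -> forall t : R, 0 < t < T ->
    is_derive t (1 : R) (fun s : R => Et (u s)) (- K (u t)).

Record dissipative_system (X : set V) (A g : V -> V) (Et K : V -> R) (C0 : R)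
    : Prop := DissipativeSystem {
  ds_space : function_space X;
  ds_A : positive_differential_operator X A;
  ds_g : operator_on X g;
  ds_Et : functional_on X Et;
  ds_K : functional_on X K;
  ds_law : energy_law X A g Et K;
  ds_bound : forall u, X u -> - C0 < Et u;
  ds_K_gt0 : forall u, X u -> ~ aeq u 0 -> 0 < K u;
  ds_K0 : 0 <= K 0
}.

End L2.

Section Scheme.
Context {R : realType}.

Definition bdf_alpha (k : nat) : R :=
  match k with
  | 1 => 1
  | 2 => 3 / 2
  | 3 => 11 / 6
  | 4 => 25 / 12
  | 5 => 137 / 60
  | _ => 0
  end.

(* Used for 1 <= k <= 5 and n >= k - 1 only. *)
Definition bdf_A (V : lmodType R) (k : nat) (u : nat -> V) (n : nat) : V :=
  match k with
  | 1 => u n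
  | 2 => 2 *: u n - (1 / 2) *: u (n - 1)%N
  | 3 => 3 *: u n - (3 / 2) *: u (n - 1)%N + (1 / 3) *: u (n - 2)%N
  | 4 => 4 *: u n - 3 *: u (n - 1)%N + (4 / 3) *: u (n - 2)%N
         - (1 / 4) *: u (n - 3)%N
  | 5 => 5 *: u n - 5 *: u (n - 1)%N + (10 / 3) *: u (n - 2)%N
         - (5 / 4) *: u (n - 3)%N + (1 / 5) *: u (n - 4)%N
  | _ => 0
  end.

Definition bdf_B (V : lmodType R) (k : nat) (u : nat -> V) (n : nat) : V :=
  match k with
  | 1 => u n
  | 2 => 2 *: u n - u (n - 1)%N
  | 3 => 3 *: u n - 3 *: u (n - 1)%N + u (n - 2)%N
  | 4 => 4 *: u n - 6 *: u (n - 1)%N + 4 *: u (n - 2)%N - u (n - 3)%N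
  | 5 => 5 *: u n - 10 *: u (n - 1)%N + 10 *: u (n - 2)%N - 5 *: u (n - 3)%N
         + u (n - 4)%N
  | _ => 0
  end.

Context {d m : nat} (Omega : set 'rV[R]_d).
Local Notation V := ('rV[R]_d -> 'rV[R]_m).

(* A run of the scheme with initial datum [uini]. The values of index 1, ..., k-1
   come from an unspecified initialization procedure, so they are unconstrained
   elements of [X]. *)
Record bdf_sav (X : set V) (A g : V -> V) (E K : V -> R) (k : nat) (dt : R)
    (uini : V) (u ub : nat -> V) (r xi : nat -> R) : Prop := BdfSav {
  bs_u_dom : forall n, X (u n);
  bs_ub_dom : forall n, X (ub n);
  bs_u0 : aeq Omega (u 0%N) uini;
  bs_ub0 : aeq Omega (ub 0%N) uini;
  bs_r0 : r 0%N = E (u 0%N);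
  bs_ub : forall n, (k <= n.+1)%N ->
    aeq Omega (dt^-1 *: (bdf_alpha k *: ub n.+1 - bdf_A k u n)
               + A (ub n.+1) + g (bdf_B k ub n)) 0;
  bs_r : forall n, (k <= n.+1)%N ->
    1 / dt * (r n.+1 - r n) = - (r n.+1 / E (ub n.+1)) * K (ub n.+1);
  bs_xi : forall n, (k <= n.+1)%N -> xi n.+1 = r n.+1 / E (ub n.+1);
  bs_u : forall n, (k <= n.+1)%N ->
    aeq Omega (u n.+1) ((1 - (1 - xi n.+1) ^+ k.+1) *: ub n.+1)
}.

End Scheme.

(* Main.v *)
(** Since [K >= 0] and [E > 0], the scheme gives [r^n = r^(n+1) (1 + dt K / E)]
    with a factor at least [1]: the sign of [r] is preserved and [|r|] decreases.
    Hence [|xi| <= |B| / E(ub)], and as [1 - (1 - xi)^(k+1)] is divisible by [xi],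
    [|eta| <= C / E(ub)] for a constant [C] (here [E >= e0] bounds [xi]). Finally
    [(L u, u) = eta^2 (L ub, ub)] with [(L ub, ub) <= 2 E(ub) + 2 |c|], so that
    [(L u, u) <= 2 C^2 (1 / E + |c| / E^2)], which [E >= e0] bounds. *)

Require Import Defs.
From HB Require Import structures.
From mathcomp Require Import all_boot all_order all_algebra.
From mathcomp Require Import all_classical all_reals all_analysis.
From mathcomp Require Import measurable_realfun ring lra.

Set Implicit Arguments.
Unset Strict Implicit.
Unset Printing Implicit Defensive.
Import Order.TTheory GRing.Theory Num.Theory.
Import numFieldNormedType.Exports.

Local Open Scope classical_set_scope.
Local Open Scope ring_scope.

(* [U] is a countable union of rational balls, each a finite intersection of strips. *)
Lemma measurable_row_of_open (R : realType) (d : nat) (U : set 'rV[R]_d) :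
  open U -> measurable (@row_of R d @^-1` U).
Proof.
move=> oU.
pose B (p : 'rV[rat]_d * nat) : set 'rV[R]_d :=
  ball (map_mx ratr p.1 : 'rV[R]_d) (p.2.+1%:R^-1 : R).
pose F p := [set t | B p `<=` U] `&` (@row_of R d @^-1` B p).
have -> : @row_of R d @^-1` U = \bigcup_p F p.
  apply/seteqP; split => [t Ut|t [p _ [BU Bt]]]; last exact: BU.
  have /nbhs_ballP[e /= e0 eU] : nbhs (row_of t) U by exact: open_nbhs_nbhs.
  (* A ball of radius below [e / 2] that contains [row_of t] lies within distance [e] of it, hence
     inside [U]. *)
  have [n ne] : exists n : nat, (n.+1%:R^-1 : R) < e / 2.
    have e20 : 0 < e / 2 by rewrite divr_gt0.
    exists (Num.truncn (e / 2)^-1).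
    by rewrite invf_plt ?posrE// truncnS_gt.
  have approx i : {q : rat | (ratr q : R) \in
      `](row_of t 0 i - n.+1%:R^-1), (row_of t 0 i + n.+1%:R^-1)[}.
    by apply/cid/rat_in_itvoo; rewrite ltrBlDr -addrA ltrDl addr_gt0.
  pose q : 'rV[rat]_d := \row_i sval (approx i).
  have tq : B (q, n) (row_of t).
    split; first by rewrite invr_gt0.
    move=> i j; rewrite !mxE /=; case: (approx j) => /= x.
    by rewrite in_itv/= /ball/= ltr_distl !mxE.
  exists (q, n) => //; split=> // y qy; apply: eU.
  have := ball_triangle (ball_sym tq) qy => /= tqy.
  apply: le_ball tqy; rewrite (splitr e); exact/ltW/ltrD.
apply: countable_bigcupT_measurable => // -[q n]; apply: measurableI.
  (* The first factor of [F] does not depend on [t], so it is either everything or empty. *)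
  by have [h|h] := pselect (B (q, n) `<=` U);
    [rewrite (_ : [set _ | _] = setT)|rewrite (_ : [set _ | _] = set0)] => //;
    apply/seteqP; split.
have -> : @row_of R d @^-1` B (q, n) = \bigcap_(i : 'I_d)
    ((fun t : d.-tuple (measurableTypeR R) => tnth t i) @^-1`
     ball (ratr (q 0 i) : R) (n.+1%:R^-1 : R)).
  apply/seteqP; split => [t [_ Bt] i _|t Bt].
    by have := Bt 0 i; rewrite !mxE.
  by split=> [|i j]; [rewrite invr_gt0|rewrite !mxE ord1; exact: Bt].
apply: fin_bigcap_measurable => // i _.
rewrite -[X in measurable X]setTI; apply: measurable_tnth => //.
by rewrite ball_itv; exact: measurable_itv.
Qed.

(** The scalars leave the integral because each product of components is integrable, being dominated
    by the sum of the two squares. The a.e. equalities then identify the integrals; measurability of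
    the domain comes from [Omega] being open. *)
Lemma inner_aeZ (R : realType) (d m : nat) (Omega : set 'rV[R]_d)
    (u v u' v' : 'rV[R]_d -> 'rV[R]_m) (a b : R) :
  open Omega -> L2 Omega u -> L2 Omega v -> L2 Omega u' -> L2 Omega v' ->
  aeq Omega u' (a *: u) -> aeq Omega v' (b *: v) ->
  inner Omega u' v' = a * b * inner Omega u v.
Proof.
move=> oO Lu Lv Lu' Lv' uu' vv'; rewrite /inner /integral_on.
have mD := measurable_row_of_open oO.
set D := _ @^-1` _ in mD *.
have msum (f g : 'rV[R]_d -> 'rV[R]_m) : L2 Omega f -> L2 Omega g ->
    measurable_fun D (fun t => \sum_(i < m) f (row_of t) 0 i * g (row_of t) 0 i).
  move=> Lf Lg; apply: measurable_sum => i.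
  by apply: measurable_funM; [case: (Lf i)|case: (Lg i)].
rewrite -RintegralZl//; last first.
  rewrite [X in integrable _ _ X](_ : _ = fun t =>
    (\sum_(i < m) (u (row_of t) 0 i * v (row_of t) 0 i)%:E)%E); last first.
    by apply/funext => t; rewrite /= sumEFin.
  apply: integrable_sum => // i _.
  have [mu iu] := Lu i; have [mv iv] := Lv i.
  apply: (le_integrable mD _ _ (integrableD mD iu iv)).
    by apply/measurable_EFinP; exact: measurable_funM.
  move=> t _ /=; rewrite lee_fin [leRHS]ger0_norm ?addr_ge0 ?sqr_ge0//.
  by rewrite ler_norml; apply/andP; split; nra.
congr fine; apply: ae_eq_integral => //.
- by apply/measurable_EFinP; exact: msum.
- by apply/measurable_EFinP; apply: measurable_funM => //; exact: msum.
- apply: filterS2 uu' vv' => t /= uu' vv' Dt; congr EFin.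
  rewrite mulr_sumr; apply: eq_bigr => i _.
  by rewrite uu'// vv'// !mxE mulrACA.
Qed.

(** The scheme fixes [u n.+1] only up to a.e. equality, and [L] is linear only on [X] and up to a.e.
    equality; this transfers the scaling by [eta] to the quadratic form. *)
Lemma quadratic_form_aeZ (R : realType) (d m : nat) (Omega : set 'rV[R]_d)
    (X : set ('rV[R]_d -> 'rV[R]_m)) (L : ('rV[R]_d -> 'rV[R]_m) -> ('rV[R]_d -> 'rV[R]_m))
    (u v : 'rV[R]_d -> 'rV[R]_m) (a : R) :
  open Omega -> function_space Omega X -> operator_on Omega X L ->
  linear_on Omega X L -> X u -> X v -> aeq Omega u (a *: v) ->
  inner Omega (L u) u = a ^+ 2 * inner Omega (L v) v.
Proof.
move=> oO [XL2 _ Xlin _] [LL2 Lae] Llin Xu Xv uv.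
rewrite expr2; apply: inner_aeZ => //; [exact: LL2|exact: XL2|exact: LL2|exact: XL2|].
(* Writing [a *: v] as a combination of [v] with itself yields homogeneity from a linearity axiom of
   the form [a *: u + v]. *)
have av : a *: v = (a - 1) *: v + v by rewrite scalerBl scale1r subrK.
have Xav : X (a *: v) by rewrite av; exact: Xlin.
have := Llin (a - 1) v v Xv Xv; rewrite -av scalerBl scale1r subrK => Lav.
by apply: filterS2 (Lae _ _ Xu Xav uv) Lav => t /= h1 h2 Ot; rewrite h1// h2.
Qed.

(** With [y = 1 - x], the geometric sum factors [1 - y ^+ n.+1] as [x] times the powers [y ^+ i] for
    [i <= n], each at most [(1 + |x|) ^+ n] in absolute value. *)
Lemma normr_subX1_le (R : realFieldType) (n : nat) (x : R) :
  `|1 - (1 - x) ^+ n.+1| <= n.+1%:R * (1 + `|x|) ^+ n * `|x|.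
Proof.
rewrite -normrN opprB subrX1 normrM addrAC subrr sub0r normrN mulrC.
apply: ler_wpM2r => //; apply: le_trans (ler_norm_sum _ _ _) _.
rewrite mulr_natl -[n.+1 in leRHS]card_ord -sumr_const; apply: ler_sum => i _.
have le1 : 1 <= 1 + `|x| by rewrite lerDl.
rewrite normrX; apply: le_trans (_ : (1 + `|x|) ^+ i <= _).
  by apply: lerXn2r; rewrite ?nnegrE ?addr_ge0// (le_trans (ler_normB _ _))// normr1.
by apply: ler_weXn2l => //; rewrite -ltnS.
Qed.

Theorem theorem1 (R : realType) (d m p : nat)
    (d_range : (1 <= d <= 3)%N) (m_gt0 : (0 < m)%N) (p_gt0 : (0 < p)%N)
    (Omega : set 'rV[R]_d)
    (Omega_domain : bounded_domain Omega) (Omega_smooth : Ck_boundary p Omega)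
    (X : set ('rV[R]_d -> 'rV[R]_m))
    (A g : ('rV[R]_d -> 'rV[R]_m) -> ('rV[R]_d -> 'rV[R]_m))
    (Et K : ('rV[R]_d -> 'rV[R]_m) -> R) (C0 : R)
    (system : dissipative_system Omega X A g Et K C0)
    (k : nat) (k_range : (1 <= k <= 5)%N) :
  let E := fun u => Et u + C0 in
  (forall dt uini u ub r xi, 0 < dt ->
     bdf_sav Omega X A g E K k dt uini u ub r xi ->
     forall n, (k <= n.+1)%N -> 0 <= r n ->
       [/\ 0 <= r n.+1, 0 <= xi n.+1,
           r n.+1 - r n = - dt * xi n.+1 * K (ub n.+1) &
           - dt * xi n.+1 * K (ub n.+1) <= 0])
  /\
  (forall (L : ('rV[R]_d -> 'rV[R]_m) -> ('rV[R]_d -> 'rV[R]_m))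
          (E1 : ('rV[R]_d -> 'rV[R]_m) -> R),
     positive_linear_operator Omega X L ->
     (forall u, X u -> E u = 1 / 2 * inner Omega (L u) u + E1 u) ->
     (exists c, forall u, X u -> c <= E1 u) ->
     (exists2 e0, 0 < e0 & forall u, X u -> e0 <= E u) ->
     forall B, exists2 Mk, 0 < Mk &
       forall dt uini u ub r xi, 0 < dt ->
         bdf_sav Omega X A g E K k dt uini u ub r xi ->
         `|r k.-1| <= B ->
         (forall j, (j < k)%N -> inner Omega (L (u j)) (u j) <= B) ->
         forall n, inner Omega (L (u n)) (u n) <= Mk ^+ 2).
Proof.
move=> E.
have [XL2 X0 Xlin Xae] := ds_space system.
have K_ge0 v : X v -> 0 <= K v.
  (* Positivity of [K] is given off the a.e.-class of zero; on that class [K] takes the value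
     [K 0]. *)
  move=> Xv; have [v0|v0] := pselect (aeq Omega v 0).
    by rewrite (ds_K system Xv X0 v0) (ds_K0 system).
  exact/ltW/(ds_K_gt0 system).
have E_gt0 v : X v -> 0 < E v.
  by move=> Xv; rewrite -[E v]/(Et v + C0) -ltrBlDr sub0r (ds_bound system).
have step dt uini u ub r xi : 0 < dt ->
    bdf_sav Omega X A g E K k dt uini u ub r xi -> forall n, (k <= n.+1)%N ->
    r n.+1 - r n = - dt * xi n.+1 * K (ub n.+1).
  move=> dt0 run n kn; have := bs_r run kn; rewrite -(bs_xi run kn) => /(congr1 ( *%R dt)).
  by rewrite mulrA div1r mulfV ?gt_eqF// mul1r => ->; ring.
have decay dt uini u ub r xi : 0 < dt ->
    bdf_sav Omega X A g E K k dt uini u ub r xi -> forall n, (k <= n.+1)%N ->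
    exists2 q, 1 <= q & r n = r n.+1 * q.
  move=> dt0 run n kn; have Xb := bs_ub_dom run n.+1.
  exists (1 + dt * (K (ub n.+1) / E (ub n.+1))).
    by rewrite lerDl mulr_ge0 ?divr_ge0 ?K_ge0 ?ltW// E_gt0.
  have := step _ _ _ _ _ _ dt0 run n kn; rewrite (bs_xi run kn) => h.
  by rewrite -[r n](subKr (r n.+1)) h; ring.
split.
  move=> dt uini u ub r xi dt0 run n kn rn; have Xb := bs_ub_dom run n.+1.
  have [q q1 rq] := decay _ _ _ _ _ _ dt0 run n kn.
  have r0 : 0 <= r n.+1.
    by move: rn; rewrite rq pmulr_lge0// (lt_le_trans ltr01).
  have xi0 : 0 <= xi n.+1 by rewrite (bs_xi run kn) divr_ge0// ltW// E_gt0.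
  split=> //; first exact: (step _ _ _ _ _ _ dt0 run n kn).
  by rewrite !mulNr oppr_le0 !mulr_ge0 ?K_ge0// ltW.
move=> L E1 [Lop Llin Lpos] EL [c cE1] [e0 e0_gt0 e0E] B.
(* [C] will bound the ratio of [|eta|] to [|xi|], and [M] is the final bound evaluated at [e = e0];
   neither involves [dt]. *)
pose C := k.+1%:R * (1 + `|B| / e0) ^+ k.
pose M := (C * `|B| / e0) ^+ 2 * (2 * e0 + 2 * `|c|).
have M_ge0 : 0 <= M.
  by rewrite mulr_ge0 ?sqr_ge0// addr_ge0// mulr_ge0// ltW.
(* [B] controls the initial indices [n < k] and [M] the others; the added [1] makes the square
   dominate both. *)
exists (1 + `|B| + M); first by rewrite -addrA ltr_pwDl// addr_ge0.
move=> dt uini u ub r xi dt0 run rB LB n.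
have bound x : x <= `|B| \/ x <= M -> x <= (1 + `|B| + M) ^+ 2.
  have B0 := normr_ge0 B; move=> xBM.
  have : x <= `|B| + M by case: xBM => h; lra.
  nra.
apply: bound.
have [nk|kn] := ltnP n k; first by left; exact: le_trans (LB _ nk) (ler_norm _).
right.
(* The induction starts at index [k - 1], the last initialized value; [j = 0] is allowed only when
   [k = 1]. *)
have rle j : (k <= j.+1)%N -> `|r j| <= `|B|.
  elim: j => [|j IH] kj.
    have k1 : k = 1%N by apply/eqP; rewrite eqn_leq kj; case/andP: k_range.
    by move: rB; rewrite k1 => /le_trans; apply; exact: ler_norm.
  move: kj; rewrite leq_eqVlt => /predU1P[kj|kj].
    by move: rB; rewrite kj => /le_trans; apply; exact: ler_norm.
  have [q q1 rq] := decay _ _ _ _ _ _ dt0 run j kj.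
  apply: le_trans (IH kj); rewrite rq normrM ler_peMr//.
  by rewrite (le_trans q1)// ler_norm.
have n0 : (0 < n)%N by case/andP: k_range => + _ => /leq_trans; exact.
case: n n0 kn => // n _ kn.
have Xb := bs_ub_dom run n.+1; have Xu := bs_u_dom run n.+1.
have oO : open Omega by case: Omega_domain.
rewrite (quadratic_form_aeZ oO (ds_space system) Lop Llin Xu Xb (bs_u run kn)).
set eta := 1 - _; set e := E (ub n.+1).
have e0e : e0 <= e by exact: e0E.
have e_gt0 : 0 < e by exact: lt_le_trans e0e.
have xi_e : `|xi n.+1| <= `|B| / e.
  rewrite (bs_xi run kn) normf_div (gtr0_norm e_gt0) ler_pM2r ?invr_gt0//.
  exact/rle/leqW.
(* The factor [|xi|] keeps its decay in [1 / e], needed against the growth of the quadratic form; in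
   the power, [e0] replaces [e]. *)
have eta_e : `|eta| <= C * `|B| / e.
  rewrite -mulrA; apply: le_trans (normr_subX1_le _ _) _.
  rewrite ler_pM// ?mulr_ge0// ?exprn_ge0 ?addr_ge0//.
  apply: ler_wpM2l => //; apply: lerXn2r; rewrite ?nnegrE ?addr_ge0 ?divr_ge0 ?(ltW e0_gt0)//.
  rewrite lerD2l; apply: le_trans xi_e _.
  by apply: ler_wpM2l => //; rewrite lef_pV2 ?posrE.
have q_e : inner Omega (L (ub n.+1)) (ub n.+1) <= 2 * e + 2 * `|c|.
  have := EL _ Xb; rewrite -/e => ->; have := cE1 _ Xb; have := ler_norm (- c).
  by rewrite normrN; lra.
have C_ge0 : 0 <= C * `|B|.
  by rewrite !mulr_ge0// exprn_ge0// addr_ge0// divr_ge0// ltW.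
apply: le_trans (_ : (C * `|B| / e) ^+ 2 * (2 * e + 2 * `|c|) <= _).
  rewrite ler_pM ?sqr_ge0 ?Lpos//.
  rewrite -(real_normK (num_real eta)); apply: lerXn2r; rewrite ?nnegrE//.
  by rewrite divr_ge0// ltW.
(* [(e + |c|) / e ^ 2 = 1 / e + |c| / e ^ 2] decreases in [e]. *)
have ie : e^-1 <= e0^-1 by rewrite lef_pV2 ?posrE.
have ie_ge0 : 0 <= e^-1 by rewrite invr_ge0 ltW.
have split_inv x : 0 < x -> (C * `|B| / x) ^+ 2 * (2 * x + 2 * `|c|) =
    2 * (C * `|B|) ^+ 2 * (x^-1 + `|c| * x^-1 ^+ 2).
  by move=> x0; field; rewrite gt_eqF.
rewrite /M !split_inv//; apply: ler_wpM2l; first by rewrite mulr_ge0// sqr_ge0.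
apply: lerD => //; apply: ler_wpM2l => //.
by apply: lerXn2r => //; rewrite ?nnegrE// (le_trans ie_ge0).
Qed.
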